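(* Let $G$ be a finite simple graph without isolated vertices on the vertex set $V(G)=[n]=\{1,\dots,n\}$, let $K$ be a field, let $S=K[x_1,\dots,x_n,y_1,\dots,y_n]$, and let $J_G\subseteq S$ be the binomial edge ideal of $G$. The following conditions are equivalent: (1) $G$ is closed, i.e. there exists a labelling of the vertices of $G$ with respect to which $G$ is closed; (2) $J_G$ has a quadratic Gröbner basis with respect to some term order $\prec$ on $S$.
   Context: For $1\le i<j\le n$ set $f_{ij}=x_iy_j-x_jy_i\in S$. The binomial edge ideal $J_G$ is the ideal of $S$ generated by all $f_{ij}$ with $i<j$ and $\{i,j\}\in E(G)$. A labelling of $G$ is a bijection $\omega:V(G)\to[n]$. The graph $G$ is closed with respect to the labelling $\omega$ if for any two distinct edges $\{u,v\},\{u,w\}\in E(G)$ sharing the vertex $u$: whenever $\omega(u)<\omega(v)$ and $\omega(u)<\omega(w)$, or $\omega(u)>\omega(v)$ and $\omega(u)>\omega(w)$, one has $\{v,w\}\in E(G)$. A term order is a monomial order on $S$ (a total order on the monomials that is multiplicative and in which $1$ is the least monomial). A quadratic Gröbner basis is a Gröbner basis all of whose elements are homogeneous polynomials of degree $2$. *)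

(* Defs.v *)
From HB Require Import structures.
From mathcomp Require Import all_boot all_order all_algebra.
From mathcomp Require Import mpoly.

Set Implicit Arguments.
Unset Strict Implicit.
Unset Printing Implicit Defensive.

Import GRing.Theory.
Local Open Scope ring_scope.

Definition no_isolated_vertex (n : nat) (e : rel 'I_n) : Prop :=
  forall u : 'I_n, exists v : 'I_n, e u v.

Definition closed_wrt (n : nat) (e : rel 'I_n) (w : 'I_n -> 'I_n) : Prop :=
  forall u v t : 'I_n, v != t -> e u v -> e u t ->
    ((w u < w v)%N /\ (w u < w t)%N) \/ ((w v < w u)%N /\ (w t < w u)%N) ->
    e v t.

Definition closed_graph (n : nat) (e : rel 'I_n) : Prop :=
  exists w : 'I_n -> 'I_n, bijective w /\ closed_wrt e w.

Definition ideal_gen (R : comNzRingType) (A : R -> Prop) (p : R) : Prop :=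
  exists s : seq (R * R),
    (forall c, c \in s -> A c.2) /\ p = \sum_(c <- s) c.1 * c.2.

(* S = K[x_1, ..., x_n, y_1, ..., y_n] is {mpoly K[n + n]}; the first n
   variables are the x_i and the last n are the y_i (with i : 'I_n). *)
Definition xvar (n : nat) (K : fieldType) (i : 'I_n) : {mpoly K[n + n]} :=
  'X_(lshift n i).
Definition yvar (n : nat) (K : fieldType) (i : 'I_n) : {mpoly K[n + n]} :=
  'X_(rshift n i).

Definition edge_binomial (n : nat) (K : fieldType) (i j : 'I_n) :
    {mpoly K[n + n]} :=
  xvar K i * yvar K j - xvar K j * yvar K i.

Definition binomial_edge_ideal (n : nat) (K : fieldType) (e : rel 'I_n) :
    {mpoly K[n + n]} -> Prop :=
  ideal_gen (fun p => exists i j : 'I_n,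
    [/\ (i < j)%N, e i j & p = edge_binomial K i j]).
Arguments binomial_edge_ideal {n} K e p.

(* [le] is the non-strict order; monomials are exponent vectors, with product
   written additively and the monomial 1 being [0%MM]. *)
Record term_order (m : nat) (le : rel 'X_{1..m}) : Prop := TermOrder {
  term_order_refl : reflexive le;
  term_order_anti : antisymmetric le;
  term_order_trans : transitive le;
  term_order_total : total le;
  term_order_mul : forall a b c : 'X_{1..m}, le a b -> le (a + c)%MM (b + c)%MM;
  term_order_one : forall a : 'X_{1..m}, le 0%MM a }.

(* For a term order, 0%MM is least and hence neutral for the maximum, so for
   p != 0 this is the largest monomial in the support of p. *)
Definition lead_monomial (m : nat) (K : fieldType) (le : rel 'X_{1..m})
    (p : {mpoly K[m]}) : 'X_{1..m} :=
  \big[(fun a b => if le a b then b else a)/0%MM]_(a <- msupp p) a.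

Definition initial_ideal (m : nat) (K : fieldType) (le : rel 'X_{1..m})
    (I : {mpoly K[m]} -> Prop) : {mpoly K[m]} -> Prop :=
  ideal_gen (fun q => exists p : {mpoly K[m]},
    [/\ I p, p != 0 & q = 'X_[lead_monomial le p]]).

Definition groebner_basis (m : nat) (K : fieldType) (le : rel 'X_{1..m})
    (I : {mpoly K[m]} -> Prop) (B : seq {mpoly K[m]}) : Prop :=
  (forall g, g \in B -> I g /\ g != 0) /\
  (forall q, initial_ideal le I q <->
     ideal_gen (fun r => exists2 g, g \in B & r = 'X_[lead_monomial le g]) q).

Definition quadratic_groebner_basis (m : nat) (K : fieldType)
    (le : rel 'X_{1..m}) (I : {mpoly K[m]} -> Prop)
    (B : seq {mpoly K[m]}) : Prop :=
  groebner_basis le I B /\ (forall g, g \in B -> g \is 2.-homog).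

(* Main.v *)
Require Import Defs.
From HB Require Import structures.
From mathcomp Require Import all_boot all_order all_algebra.
From mathcomp Require Import mpoly.
From mathcomp Require Import zify ring.

Set Implicit Arguments.
Unset Strict Implicit.
Unset Printing Implicit Defensive.

Import Order.TTheory GRing.Theory.
Local Open Scope ring_scope.

(** If J_G has a quadratic Groebner basis for [le], declare i before j when
    x_i y_j > x_j y_i: since monomials cancel this is a total order, hence a
    labelling.  A quadric of J_G is a linear combination of edge binomials, so
    every leading monomial of J_G is divisible by some x_a y_b with {a, b} an edge
    and a before b.  If {u, v} and {u, t} are edges with u before v and t, then
    y_u f_vt lies in J_G, and its leading monomial forces {v, t} to be an edge;
    dually for x_u f_vt.

    Conversely, given a closed labelling, take an order with x_i y_j > x_j y_i
    whenever i is labelled below j.  Closedness makes the rewriting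
    x_i y_j -> x_j y_i along edges satisfy the diamond property, so the monomials
    that rewrite to a given irreducible m form a full class modulo J_G and are all
    larger than m.  The sum of the coefficients over that class vanishes on J_G,
    hence m cannot be the leading monomial of an element of J_G. *)

(** * Ideals given by generators, and monomial ideals *)

Lemma ideal_gen_mem (R : comNzRingType) (A : R -> Prop) (p : R) :
  A p -> ideal_gen A p.
Proof.
move=> Ap; exists [:: (1, p)]; split; last by rewrite big_seq1 mul1r.
by move=> c; rewrite inE => /eqP ->.
Qed.

Lemma ideal_genMl (R : comNzRingType) (A : R -> Prop) (q p : R) :
  ideal_gen A p -> ideal_gen A (q * p).
Proof.
case=> s [sA ->]; exists [seq (q * c.1, c.2) | c <- s]; split.
  by move=> c /mapP[d /sA Ad ->].
by rewrite big_map mulr_sumr; apply: eq_bigr => c _; rewrite mulrA.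
Qed.

Lemma ideal_genN (R : comNzRingType) (A : R -> Prop) (p : R) :
  ideal_gen A p -> ideal_gen A (- p).
Proof. by rewrite -mulN1r; exact: ideal_genMl. Qed.

Lemma ideal_genD (R : comNzRingType) (A : R -> Prop) (p q : R) :
  ideal_gen A p -> ideal_gen A q -> ideal_gen A (p + q).
Proof.
move=> [s [sA ->]] [t [tA ->]]; exists (s ++ t); split; last by rewrite big_cat.
by move=> c; rewrite mem_cat => /orP[/sA|/tA].
Qed.

Lemma ideal_gen_sub (R : comNzRingType) (A B : R -> Prop) (p : R) :
  (forall q, A q -> ideal_gen B q) -> ideal_gen A p -> ideal_gen B p.
Proof.
move=> AB [s [sA ->]]; elim: s sA => [|c s IHs] sA.
  by rewrite big_nil; exists [::]; rewrite big_nil.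
rewrite big_cons; apply: ideal_genD.
  by apply/ideal_genMl/AB/sA; rewrite mem_head.
by apply: IHs => d ds; apply: sA; rewrite in_cons ds orbT.
Qed.

Lemma msupp_mulX (m : nat) (R : nzRingType) (p : {mpoly R[m]}) (a b : 'X_{1..m}) :
  (p * 'X_[a])@_b != 0 -> (a <= b)%MM.
Proof.
rewrite -mcoeff_msupp (perm_mem (msuppMX p a)) => /mapP[c _ ->].
exact: lem_addr.
Qed.

(** The coefficient of ['X_[a]] is 1, so some summand [c.1 * c.2] contains [a], and all monomials of
    that summand are multiples of its generator. *)
Lemma monomial_ideal_mem (m : nat) (K : fieldType) (M : 'X_{1..m} -> Prop)
    (a : 'X_{1..m}) :
  ideal_gen (fun q : {mpoly K[m]} => exists2 b, M b & q = 'X_[b]) 'X_[a] ->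
  exists2 b, M b & (b <= a)%MM.
Proof.
case=> s [sM Xa].
have /hasP[c cs ca] : has (fun c => (c.1 * c.2)@_a != 0) s.
  apply: contraT => /hasPn s0.
  move: (congr1 (mcoeff a) Xa); rewrite mcoeffX eqxx raddf_sum big1_seq.
    by move/eqP; rewrite oner_eq0.
  by move=> c /= /s0; rewrite negbK => /eqP.
have [b Mb cE] := sM _ cs; exists b => //; move: ca; rewrite cE.
exact: msupp_mulX.
Qed.

(** * Term orders and leading monomials *)

(** Were [b] below [a], the two sums would be equal by antisymmetry; then [a = b] by cancellation of
    exponents. *)
Lemma term_order_add2r (m : nat) (le : rel 'X_{1..m}) (a b c : 'X_{1..m}) :
  term_order le -> le (a + c)%MM (b + c)%MM = le a b.
Proof.
case=> lexx le_anti le_trans le_total le_mul _; apply/idP/idP; last exact: le_mul.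
move=> le_ab; have /orP[//|/le_mul le_ba] := le_total a b.
have /le_anti/addIm -> : le (a + c)%MM (b + c)%MM && le (b + c)%MM (a + c)%MM.
  by rewrite le_ab le_ba.
exact: lexx.
Qed.

Lemma lead_monomialP (m : nat) (K : fieldType) (le : rel 'X_{1..m})
    (p : {mpoly K[m]}) : term_order le -> p != 0 ->
  lead_monomial le p \in msupp p /\
  (forall a, a \in msupp p -> le a (lead_monomial le p)).
Proof.
case=> lexx le_anti le_trans le_total _ le0.
rewrite -msupp_eq0 /lead_monomial; elim: (msupp p) => // a s IHs _.
rewrite big_cons; set b := \big[_/_]_(_ <- s) _ in IHs *.
have [s0|s_neq0] := eqVneq s [::].
  (* On an empty tail the maximum is the default [0%MM], which is least and so never beats [a]. *)
  have -> : (if le a b then b else a) = a.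
    rewrite /b s0 big_nil; case: ifP => // a0.
    by apply: le_anti; rewrite a0 le0.
  by rewrite s0 mem_head; split=> // c; rewrite inE => /eqP ->.
have [bs leb] := IHs s_neq0.
case: ifP => [ab|/negbT nab].
  rewrite in_cons bs orbT; split=> // c; rewrite in_cons => /orP[/eqP -> //|].
  exact: leb.
have ba : le b a by have /orP[/(negP nab)|] := le_total a b.
rewrite mem_head; split=> // c; rewrite in_cons => /orP[/eqP -> //|/leb cb].
exact: le_trans ba.
Qed.

(** * The monomials x_i y_j and the edge binomials *)

(* Locked so that additive lemmas such as [mnmDE] do not split it. *)
HB.lock Definition xymon (n : nat) (i j : 'I_n) : 'X_{1..n + n} :=
  (U_(lshift n i) + U_(rshift n j))%MM.

Lemma xymon_lshift (n : nat) (i j k : 'I_n) :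
  xymon i j (lshift n k) = (i == k) :> nat.
Proof. by rewrite xymon.unlock mnmDE !mnm1E eq_lshift eq_rlshift addn0. Qed.

Lemma xymon_rshift (n : nat) (i j k : 'I_n) :
  xymon i j (rshift n k) = (j == k) :> nat.
Proof. by rewrite xymon.unlock mnmDE !mnm1E eq_rshift eq_lrshift. Qed.

Lemma mdeg_xymon (n : nat) (i j : 'I_n) : mdeg (xymon i j) = 2%N.
Proof. by rewrite xymon.unlock mdegD !mdeg1. Qed.

Lemma xymon_inj (n : nat) (i j k l : 'I_n) :
  xymon i j = xymon k l -> i = k /\ j = l.
Proof.
move=> E; split; apply/eqP.
  by have := xymon_lshift i j k; rewrite E xymon_lshift eqxx; case: eqP.
by have := xymon_rshift i j l; rewrite E xymon_rshift eqxx; case: eqP.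
Qed.

Lemma xymon_le (n : nat) (i j : 'I_n) (a : 'X_{1..n + n}) :
  (xymon i j <= a)%MM -> (0 < a (lshift n i))%N /\ (0 < a (rshift n j))%N.
Proof.
move=> /mnm_lepP le_a; split.
  by have := le_a (lshift n i); rewrite xymon_lshift eqxx.
by have := le_a (rshift n j); rewrite xymon_rshift eqxx.
Qed.

Lemma edge_binomialE (n : nat) (K : fieldType) (i j : 'I_n) :
  edge_binomial K i j = 'X_[xymon i j] - 'X_[xymon j i].
Proof. by rewrite xymon.unlock !mpolyXD. Qed.

Lemma edge_binomialC (n : nat) (K : fieldType) (i j : 'I_n) :
  edge_binomial K i j = - edge_binomial K j i.
Proof. by rewrite /edge_binomial opprB. Qed.

Lemma edge_binomial_mem (n : nat) (K : fieldType) (e : rel 'I_n) (i j : 'I_n) :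
  ssrbool.symmetric e -> irreflexive e -> e i j ->
  binomial_edge_ideal K e (edge_binomial K i j).
Proof.
move=> e_sym e_irr eij; have [ij|ji|/val_inj ij] := ltngtP i j.
- by apply: ideal_gen_mem; exists i, j.
- rewrite edge_binomialC; apply/ideal_genN/ideal_gen_mem.
  by exists j, i; rewrite e_sym.
- by move: eij; rewrite ij e_irr.
Qed.

(** * Coefficient sums that vanish on J_G, and the quadrics of J_G *)

(* J_G is spanned by the differences of the monomials k x_i y_j and k x_j y_i,
   so it is killed by the sum of the coefficients over a union of classes. *)
Lemma sum_mcoeff_eq0 (n : nat) (K : fieldType) (e : rel 'I_n)
    (s : seq 'X_{1..n + n}) (p : {mpoly K[n + n]}) :
  (forall k i j, e i j ->
     count_mem (k + xymon i j)%MM s = count_mem (k + xymon j i)%MM s) ->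
  binomial_edge_ideal K e p -> \sum_(m <- s) p@_m = 0.
Proof.
move=> s_inv [t [tJ ->]].
have sumX (a : 'X_{1..n + n}) :
    \sum_(m <- s) ('X_[a] : {mpoly K[n + n]})@_m = (count_mem a s)%:R.
  elim: s {s_inv} => [|b s IHs]; first by rewrite big_nil.
  by rewrite big_cons /= natrD IHs mcoeffX eq_sym.
under eq_bigr do rewrite raddf_sum /=.
rewrite exchange_big big1_seq // => -[q f] /= /tJ /= [i [j [_ eij ->]]].
(* Expanding the cofactor [q] into monomials [k] leaves scalar multiples of differences whose two
   monomials are counted equally often in [s]. *)
rewrite [q]mpolyE mulr_suml; under eq_bigr do rewrite raddf_sum /=.
rewrite exchange_big big1 // => k _.
under eq_bigr => m _.
  rewrite -scalerAl mcoeffZ edge_binomialE mulrBr -!mpolyXD raddfB /=.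
  over.
by rewrite -mulr_sumr sumrB !sumX (s_inv k i j eij) subrr mulr0.
Qed.

(* The degree-2 part of J_G is spanned by the generators, whose supports are
   disjoint. *)
Lemma quadric_msupp (n : nat) (K : fieldType) (e : rel 'I_n)
    (g : {mpoly K[n + n]}) (m : 'X_{1..n + n}) :
  ssrbool.symmetric e -> binomial_edge_ideal K e g -> g \is 2.-homog ->
  m \in msupp g ->
  exists i j, [/\ e i j, m = xymon i j & xymon j i \in msupp g].
Proof.
move=> e_sym Jg g_hom mg.
have mdeg_m : mdeg m = 2%N by move/dhomogP: g_hom; exact.
have add_xymon k i j (a : 'X_{1..n + n}) :
    mdeg a = 2%N -> (k + xymon i j)%MM = a -> k = 0%MM /\ a = xymon i j.
  move=> mdeg_a aE; move: mdeg_a; rewrite -aE mdegD mdeg_xymon => /eqP.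
  by rewrite -{2}[2%N]add0n eqn_add2r mdeg_eq0 => /eqP ->; rewrite add0m.
have add_xymonC k (i j a b : 'I_n) :
    (k + xymon i j)%MM = xymon a b -> (k + xymon j i)%MM = xymon b a.
  by case/(add_xymon _ _ _ _ (mdeg_xymon a b)) => -> /xymon_inj[-> ->]; rewrite add0m.
have add_xymon_eq k (i j a b : 'I_n) :
    ((k + xymon i j)%MM == xymon a b) = ((k + xymon j i)%MM == xymon b a).
  by apply/eqP/eqP => /add_xymonC.
case: (boolP [exists i, exists j, e i j && (m == xymon i j)]) => [|no_ij].
  case/existsP=> i /existsP[j /andP[eij /eqP mE]]; exists i, j; split=> //.
  (* In degree 2 the cofactor [k] is trivial, so x_i y_j and x_j y_i form a full class and their
     coefficients are opposite. *)
  have : \sum_(a <- [:: xymon i j; xymon j i]) g@_a = 0.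
    apply: sum_mcoeff_eq0 Jg => k a b eab.
    rewrite /= !addn0 ![xymon i j == _]eq_sym ![xymon j i == _]eq_sym.
    by rewrite (add_xymon_eq k a b i j) (add_xymon_eq k a b j i) addnC.
  rewrite big_cons big_seq1 => /eqP; rewrite addr_eq0 => /eqP gij.
  by move: mg; rewrite !mcoeff_msupp mE gij oppr_eq0.
(* A quadratic monomial that is no x_i y_j along an edge is a class by itself, so its coefficient
   would vanish. *)
have : \sum_(a <- [:: m]) g@_a = 0.
  apply: sum_mcoeff_eq0 Jg => k i j eij.
  have m_neq a b : e a b -> (m == (k + xymon a b)%MM) = false.
    move=> eab; apply: contraNF no_ij => /eqP mE.
    have [_ mE'] := add_xymon k a b m mdeg_m (esym mE).
    by apply/existsP; exists a; apply/existsP; exists b; rewrite eab mE' /=.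
  by rewrite /= !m_neq // e_sym.
by rewrite big_seq1 => /eqP; rewrite mcoeff_eq0 mg.
Qed.

(** * From a quadratic Groebner basis to a closed labelling *)

(** The label of a vertex is its position in the list of vertices sorted by [r]. *)
Lemma total_order_labelling (n : nat) (r : rel 'I_n) :
  antisymmetric r -> transitive r -> total r ->
  exists w : 'I_n -> 'I_n, bijective w /\ forall i j, (w i < w j)%N -> r i j.
Proof.
move=> r_anti r_trans r_total; pose s := sort r (enum 'I_n).
have sP i : i \in s by rewrite mem_sort mem_enum.
have idx_lt i : (index i s < n)%N.
  by rewrite -[X in (_ < X)%N](size_enum_ord n) -(size_sort r) index_mem.
exists (fun i => Ordinal (idx_lt i)); split.
  by apply: injF_bij => i j [] /index_inj; apply.
move=> i j /=; apply: sorted_ltn_index => //.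
exact: sort_sorted.
Qed.

Lemma quadratic_groebner_closed (n : nat) (K : fieldType) (e : rel 'I_n)
    (le : rel 'X_{1..n + n}) (B : seq {mpoly K[n + n]}) :
  ssrbool.symmetric e -> irreflexive e -> term_order le ->
  quadratic_groebner_basis le (binomial_edge_ideal K e) B -> closed_graph e.
Proof.
move=> e_sym e_irr le_to [[BJ B_gb] B_hom].
have [lexx le_anti le_trans le_total le_mul le0] := le_to.
pose r := [rel i j : 'I_n | le (xymon j i) (xymon i j)].
have r_anti : antisymmetric r.
  by move=> i j /= /le_anti /xymon_inj[].
have r_trans : transitive r.
  (* After multiplication by x_j y_j: x_k y_i x_j y_j = x_j y_i x_k y_j <= x_i y_j x_k y_j <= x_i
     y_j x_j y_k = x_i y_k x_j y_j. *)
  rewrite /r => j i k /= rij rjk; rewrite -(term_order_add2r _ _ (xymon j j) le_to).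
  have -> : (xymon k i + xymon j j)%MM = (xymon j i + xymon k j)%MM.
    by rewrite xymon.unlock; apply/mnmP => z; rewrite !mnmDE; lia.
  have -> : (xymon i k + xymon j j)%MM = (xymon j k + xymon i j)%MM.
    by rewrite xymon.unlock; apply/mnmP => z; rewrite !mnmDE; lia.
  apply: le_trans (le_mul _ _ (xymon k j) rij) _.
  by rewrite [(xymon i j + _)%MM]addmC; exact: le_mul.
have r_total : total r by move=> i j; exact: le_total.
have [w [w_bij w_r]] := total_order_labelling r_anti r_trans r_total.
exists w; split=> //.
have r_w i j : i != j -> r i j -> (w i < w j)%N.
  move=> ij rij; have [//|/w_r rji|/val_inj /(bij_inj w_bij) ijE] := ltngtP (w i) (w j).
    by move: ij; rewrite (r_anti i j (introT andP (conj rij rji))) eqxx.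
  by move: ij; rewrite ijE eqxx.
(* Here [i] and [j] need not be adjacent: only the multiple of [f_ij] by the
   monomial [k] is assumed to lie in J_G. *)
have lead_edge k i j : i != j -> (w i < w j)%N ->
    binomial_edge_ideal K e ('X_[k] * edge_binomial K i j) ->
    exists a b, [/\ e a b, (w a < w b)%N & (xymon a b <= k + xymon i j)%MM].
  move=> ij wij Jp; set p := _ * _ in Jp.
  have pE : p = 'X_[(k + xymon i j)%MM] - 'X_[(k + xymon j i)%MM].
    by rewrite /p edge_binomialE mulrBr -!mpolyXD.
  have neq : (k + xymon i j)%MM != (k + xymon j i)%MM.
    apply: contra ij => /eqP; rewrite [LHS]addmC [RHS]addmC => /addIm/xymon_inj[->].
    by rewrite eqxx.
  have p_supp : (k + xymon i j)%MM \in msupp p.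
    rewrite mcoeff_msupp pE mcoeffB !mcoeffX eqxx [_ == (k + xymon i j)%MM]eq_sym.
    by rewrite (negPf neq) subr0 oner_eq0.
  have p_neq0 : p != 0 by rewrite -msupp_eq0; apply: contraTneq p_supp => ->.
  have [lm_p lm_max] := lead_monomialP le_to p_neq0.
  have lmE : lead_monomial le p = (k + xymon i j)%MM.
    apply: le_anti; rewrite lm_max //.
    rewrite andbT; move: lm_p; rewrite pE => /msuppB_le.
    rewrite !msuppX !inE => /orP[] /eqP ->; first exact: lexx.
    by rewrite ![(k + _)%MM]addmC; exact/le_mul/w_r.
  have : initial_ideal le (binomial_edge_ideal K e) 'X_[(k + xymon i j)%MM].
    by apply: ideal_gen_mem; exists p; rewrite lmE.
  move/B_gb.
  have sub (q : {mpoly K[n + n]}) :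
      (exists2 g, g \in B & q = 'X_[lead_monomial le g]) ->
      ideal_gen (fun q => exists2 b, (exists2 g, g \in B & b = lead_monomial le g)
        & q = 'X_[b]) q.
    by case=> g gB ->; apply: ideal_gen_mem; exists (lead_monomial le g) => //; exists g.
  move=> /(ideal_gen_sub sub) /monomial_ideal_mem [_ [g gB ->] g_le].
  have [Jg g_neq0] := BJ g gB.
  have [lm_g g_max] := lead_monomialP le_to g_neq0.
  have [a [b [eab lm_gE ba_g]]] := quadric_msupp e_sym Jg (B_hom g gB) lm_g.
  exists a, b; split=> //; last by rewrite -lm_gE.
  apply: r_w; first by apply: contraTneq eab => ->; rewrite e_irr.
  by rewrite /r /= -lm_gE; exact: g_max.
have mul_edge q i j : e i j -> binomial_edge_ideal K e (q * edge_binomial K i j).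
  by move=> eij; apply/ideal_genMl/edge_binomial_mem.
have closed_lt u v t : e u v -> e u t -> (w v < w t)%N ->
    ((w u < w v)%N /\ (w u < w t)%N) \/ ((w v < w u)%N /\ (w t < w u)%N) -> e v t.
  move=> euv eut vt uvt; have v_neq_t : v != t by apply: contraTneq vt => ->; rewrite ltnn.
  have [[uv ut]|[vu tu]] := uvt.
    have [] := @lead_edge U_(rshift n u)%MM v t v_neq_t vt.
      have -> : 'X_[U_(rshift n u)] * edge_binomial K v t =
          yvar K v * edge_binomial K u t - yvar K t * edge_binomial K u v.
        by rewrite /edge_binomial /xvar /yvar; ring.
      by apply: ideal_genD; [|apply: ideal_genN]; exact: mul_edge.
    (* In y_u x_v y_t the only x is x_v, so [a = v] and [b] is [t] or [u]; [b = u] is excluded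
       because [u] comes before [v]. *)
    move=> a [b [eab ab /xymon_le[]]]; rewrite !mnmDE xymon_lshift xymon_rshift.
    rewrite !mnm1E eq_rlshift eq_rshift add0n.
    case: eqP => // va _; case: (t =P b) => [tb _|_]; first by rewrite va tb.
    by case: eqP => // ub; move: ab; rewrite -va -ub ltnNge ltnW.
  have [] := @lead_edge U_(lshift n u)%MM v t v_neq_t vt.
    have -> : 'X_[U_(lshift n u)] * edge_binomial K v t =
        xvar K v * edge_binomial K u t - xvar K t * edge_binomial K u v.
      by rewrite /edge_binomial /xvar /yvar; ring.
    by apply: ideal_genD; [|apply: ideal_genN]; exact: mul_edge.
  (* Dually, x_u x_v y_t forces [b = t], and [a = u] is excluded because [t] comes before [u]. *)
  move=> a [b [eab ab /xymon_le[]]]; rewrite !mnmDE xymon_lshift xymon_rshift.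
  rewrite !mnm1E eq_lrshift eq_lshift add0n.
  case: (v =P a) => [va _|_].
    by case: (t =P b) => // tb; rewrite va tb.
  case: (u =P a) => // ua _; case: (t =P b) => // tb.
  by move: ab; rewrite -ua -tb ltnNge ltnW.
move=> u v t v_neq_t euv eut uvt; have [vt|tv|/val_inj/(bij_inj w_bij) vt] := ltngtP (w v) (w t).
- exact: closed_lt euv eut vt uvt.
- by rewrite e_sym; apply: closed_lt eut euv tv _; case: uvt => -[]; [left|right].
- by move: v_neq_t; rewrite vt eqxx.
Qed.

(** * Rewriting monomials along the edges *)

(** Only vertices are quantified, which keeps the relation boolean; the cofactor is recovered in
    [swapP]. The last equation is additive to avoid truncated subtraction of exponents. *)
Definition swap (n : nat) (e : rel 'I_n) (w : 'I_n -> 'I_n) (a b : 'X_{1..n + n}) :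
    bool :=
  [exists i, exists j, [&& e i j, (w i < w j)%N, (xymon i j <= a)%MM &
    b + xymon i j == a + xymon j i]%MM].

Lemma swapP (n : nat) (e : rel 'I_n) (w : 'I_n -> 'I_n) (a b : 'X_{1..n + n}) :
  reflect (exists k i j, [/\ e i j, (w i < w j)%N, a = k + xymon i j
    & b = k + xymon j i]%MM) (swap e w a b).
Proof.
apply: (iffP existsP) => [[i /existsP[j /and4P[eij wij ija /eqP bE]]]|].
  exists (a - xymon i j)%MM, i, j; split=> //; first by rewrite submK.
  apply: (@addIm _ (xymon i j)); rewrite -[in RHS]addmA [(xymon j i + _)%MM]addmC.
  by rewrite addmA submK.
case=> k [i [j [eij wij -> ->]]]; exists i; apply/existsP; exists j.
rewrite eij wij lem_addl; apply/eqP.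
by apply/mnmP => z; rewrite !mnmDE; lia.
Qed.

Lemma swap_mdeg (n : nat) (e : rel 'I_n) (w : 'I_n -> 'I_n) (a b : 'X_{1..n + n}) :
  swap e w a b -> mdeg a = mdeg b.
Proof.
by case/swapP=> k [i [j [_ _ -> ->]]]; rewrite !mdegD !mdeg_xymon.
Qed.

(** Two steps whose redexes share no variable commute. If they share x_i, or share y_j, closedness
    makes the two other endpoints adjacent, and one further step along that edge joins the
    results. *)
Lemma swap_diamond (n : nat) (e : rel 'I_n) (w : 'I_n -> 'I_n)
    (a b c : 'X_{1..n + n}) :
  ssrbool.symmetric e -> bijective w -> closed_wrt e w ->
  swap e w a b -> swap e w a c ->
  [\/ b = c, swap e w b c, swap e w c b |
    exists2 d, swap e w b d & swap e w c d].
Proof.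
move=> e_sym w_bij e_closed /swapP[k [i [j [eij wij -> ->]]]].
case/swapP=> k' [i' [j' [eij' wij' kE ->]]].
have kEl z : (k (lshift n z) + (i == z) = k' (lshift n z) + (i' == z))%N.
  by move/mnmP: kE => /(_ (lshift n z)); rewrite !mnmDE !xymon_lshift.
have kEr z : (k (rshift n z) + (j == z) = k' (rshift n z) + (j' == z))%N.
  by move/mnmP: kE => /(_ (rshift n z)); rewrite !mnmDE !xymon_rshift.
have swap_add q u v : e u v -> (w u < w v)%N ->
    swap e w (q + xymon u v)%MM (q + xymon v u)%MM.
  by move=> euv wuv; apply/swapP; exists q, u, v.
have [ii|ii] := eqVneq i i'; have [jj|jj] := eqVneq j j'.
- by apply: Or41; move: kE; rewrite ii jj => /addIm ->.
- subst i'; have ejj : e j j' by apply: (e_closed i); auto.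
  (* As [j] and [j'] differ, y_j' divides the cofactor [k], so [a] is q x_i y_j y_j'; the results
     are q y_i x_j y_j' and q y_i x_j' y_j. *)
  have jk : (U_(rshift n j') <= k)%MM.
    apply/mnm_lepP => z; rewrite mnm1E; case: eqP => // <-.
    by have := kEr j'; rewrite eqxx (negPf jj); lia.
  set q := (k - U_(rshift n j'))%MM.
  have k_q : k = (q + U_(rshift n j'))%MM by rewrite submK.
  have k'_q : k' = (q + U_(rshift n j))%MM.
    apply: (@addIm _ (xymon i j')); rewrite -kE k_q xymon.unlock.
    by apply/mnmP => z; rewrite !mnmDE; lia.
  have bE : (k + xymon j i)%MM = (q + U_(rshift n i) + xymon j j')%MM.
    by rewrite k_q xymon.unlock; apply/mnmP => z; rewrite !mnmDE; lia.
  have cE : (k' + xymon j' i)%MM = (q + U_(rshift n i) + xymon j' j)%MM.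
    by rewrite k'_q xymon.unlock; apply/mnmP => z; rewrite !mnmDE; lia.
  rewrite bE cE; have [wjj|wjj|/val_inj/(bij_inj w_bij) jE] := ltngtP (w j) (w j').
  + by apply: Or42; exact: swap_add.
  + by apply: Or43; apply: swap_add; rewrite // e_sym.
  + by move: jj; rewrite jE eqxx.
- subst j'; have eii : e i i'.
    by apply: (e_closed j); rewrite // 1?e_sym //; auto.
  have ik : (U_(lshift n i') <= k)%MM.
    apply/mnm_lepP => z; rewrite mnm1E; case: eqP => // <-.
    by have := kEl i'; rewrite eqxx (negPf ii); lia.
  set q := (k - U_(lshift n i'))%MM.
  have k_q : k = (q + U_(lshift n i'))%MM by rewrite submK.
  have k'_q : k' = (q + U_(lshift n i))%MM.
    apply: (@addIm _ (xymon i' j)); rewrite -kE k_q xymon.unlock.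
    by apply/mnmP => z; rewrite !mnmDE; lia.
  have bE : (k + xymon j i)%MM = (q + U_(lshift n j) + xymon i' i)%MM.
    by rewrite k_q xymon.unlock; apply/mnmP => z; rewrite !mnmDE; lia.
  have cE : (k' + xymon j i')%MM = (q + U_(lshift n j) + xymon i i')%MM.
    by rewrite k'_q xymon.unlock; apply/mnmP => z; rewrite !mnmDE; lia.
  rewrite bE cE; have [wii|wii|/val_inj/(bij_inj w_bij) iE] := ltngtP (w i) (w i').
  + by apply: Or43; exact: swap_add.
  + by apply: Or42; apply: swap_add; rewrite // e_sym.
  + by move: ii; rewrite iE eqxx.
(* The redexes are coprime here, so the second one divides the cofactor of the first. *)
have k_ge : (xymon i' j' <= k)%MM.
  apply/mnm_lepP => z; case: (split_ordP z) => {}z ->.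
    rewrite xymon_lshift; case: eqP => // <-.
    by have := kEl i'; rewrite eqxx (negPf ii); lia.
  rewrite xymon_rshift; case: eqP => // <-.
  by have := kEr j'; rewrite eqxx (negPf jj); lia.
set q := (k - xymon i' j')%MM.
have k_q : k = (q + xymon i' j')%MM by rewrite submK.
have k'_q : k' = (q + xymon i j)%MM.
  apply: (@addIm _ (xymon i' j')); rewrite -kE k_q.
  by apply/mnmP => z; rewrite !mnmDE; lia.
apply: Or44; exists (q + xymon j i + xymon j' i')%MM.
  by rewrite k_q -addmA [(xymon i' j' + _)%MM]addmC addmA; exact: swap_add.
rewrite k'_q -[X in swap _ _ X]addmA [(xymon i j + _)%MM]addmC addmA.
by rewrite -[X in swap _ _ _ X]addmA [(xymon j i + _)%MM]addmC addmA; exact: swap_add.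
Qed.

(* Restricting to bounded degree gives a finite type, where reachability is
   decidable. *)
Definition bswap (n : nat) (e : rel 'I_n) (w : 'I_n -> 'I_n) (d : nat) :
    rel (bmultinom (n + n) d) :=
  fun a b => swap e w a b.

(* Moving the one-step diamond along the path from [a] to an irreducible [m]
   shows that every successor of [a] still reaches [m]. *)
Lemma connect_bswap (n : nat) (e : rel 'I_n) (w : 'I_n -> 'I_n) (d : nat)
    (m a b : bmultinom (n + n) d) :
  ssrbool.symmetric e -> bijective w -> closed_wrt e w ->
  (forall c : 'X_{1..n + n}, ~~ swap e w m c) ->
  swap e w a b ->
  connect (@bswap n e w d) a m = connect (@bswap n e w d) b m.
Proof.
move=> e_sym w_bij e_closed m_irr ab.
apply/idP/idP; last by apply: connect_trans; exact: connect1.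
case/connectP=> p; elim: p a b ab => [|c p IHp] a b ab /=.
  by move=> _ mE; move: ab; rewrite -mE (negPf (m_irr b)).
case/andP=> ac cp mE.
have cm : connect (@bswap n e w d) c m by apply/connectP; exists p.
have [/val_inj -> //|bc|cb|[f bf cf]] := swap_diamond e_sym w_bij e_closed ab ac.
- by apply: connect_trans cm; exact: connect1.
- exact: IHp cb cp mE.
have fd : (mdeg f < d)%N by rewrite -(swap_mdeg bf) bmdeg.
pose df : bmultinom (n + n) d := BMultinom fd.
have df_m : connect (@bswap n e w d) df m := IHp c df cf cp mE.
by apply: connect_trans df_m; apply: connect1; exact: bf.
Qed.

(** * A term order that decreases under rewriting *)

(** Each x_i weighs more the smaller its label, and each y_j weighs 0, so x_i y_j outweighs x_j y_i
    when [w i < w j]. Labels are below [n], so the subtraction never truncates. *)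
Definition xweight (n : nat) (w : 'I_n -> 'I_n) (a : 'X_{1..n + n}) : nat :=
  \sum_i a (lshift n i) * (n - w i).

Lemma xweightD (n : nat) (w : 'I_n -> 'I_n) (a b : 'X_{1..n + n}) :
  xweight w (a + b)%MM = (xweight w a + xweight w b)%N.
Proof.
by rewrite /xweight -big_split; apply: eq_bigr => i _; rewrite mnmDE mulnDl.
Qed.

Lemma xweight0 (n : nat) (w : 'I_n -> 'I_n) : xweight w 0%MM = 0%N.
Proof. by rewrite /xweight big1 // => i _; rewrite mnm0E. Qed.

Lemma xweight_xymon (n : nat) (w : 'I_n -> 'I_n) (i j : 'I_n) :
  xweight w (xymon i j) = (n - w i)%N.
Proof.
rewrite /xweight (bigD1 i) //= big1 ?addn0 => [|k ki].
  by rewrite xymon_lshift eqxx mul1n.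
by rewrite xymon_lshift eq_sym (negPf ki).
Qed.

Lemma swap_xweight (n : nat) (e : rel 'I_n) (w : 'I_n -> 'I_n)
    (a b : 'X_{1..n + n}) : swap e w a b -> (xweight w b < xweight w a)%N.
Proof.
case/swapP=> k [i [j [_ wij -> ->]]]; rewrite !xweightD !xweight_xymon.
by have := ltn_ord (w j); lia.
Qed.

Lemma connect_bswap_xweight (n : nat) (e : rel 'I_n) (w : 'I_n -> 'I_n) (d : nat)
    (a m : bmultinom (n + n) d) :
  connect (@bswap n e w d) a m -> a != m -> (xweight w m < xweight w a)%N.
Proof.
case/connectP=> p; elim: p a => [|b p IHp] a /=; first by move=> _ ->; rewrite eqxx.
case/andP=> /swap_xweight ab bp mE _.
have [-> //|bm] := eqVneq m b.
by apply: ltn_trans ab; apply: IHp; rewrite // eq_sym.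
Qed.

(** Ties in weight are broken by the ambient total order on monomials. *)
Definition xweight_le (n : nat) (w : 'I_n -> 'I_n) : rel 'X_{1..n + n} :=
  fun a b => (xweight w a < xweight w b)%N
             || (xweight w a == xweight w b) && (a <= b)%O.

Lemma xweight_term_order (n : nat) (w : 'I_n -> 'I_n) : term_order (xweight_le w).
Proof.
rewrite /xweight_le; split.
- by move=> a; rewrite eqxx lexx orbT.
- move=> a b /andP[]; case: ltngtP => //= _ ab ba.
  by apply: le_anti; rewrite ab ba.
- move=> b a c; case: ltngtP => [ab _||ab /=] //.
    by case: ltngtP => [bc _||<- _] //; rewrite ?(ltn_trans ab bc) ?ab.
  by move=> le_ab; rewrite ab; case: ltngtP => //= _; exact: le_trans.
- by move=> a b; case: ltngtP => //= _; exact: le_total.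
- by move=> a b c; rewrite !xweightD ltn_add2r eqn_add2r lemc_add2l.
- by move=> a; rewrite xweight0 le0m andbT orbC eq_sym; case: xweight.
Qed.

(** * From a closed labelling to a quadratic Groebner basis *)

Lemma closed_lead_dvd (n : nat) (K : fieldType) (e : rel 'I_n) (w : 'I_n -> 'I_n)
    (p : {mpoly K[n + n]}) :
  ssrbool.symmetric e -> bijective w -> closed_wrt e w ->
  binomial_edge_ideal K e p -> p != 0 ->
  exists i j, [/\ e i j, (w i < w j)%N
    & (xymon i j <= lead_monomial (xweight_le w) p)%MM].
Proof.
move=> e_sym w_bij e_closed Jp p_neq0.
have [lm_p lm_max] := lead_monomialP (xweight_term_order w) p_neq0.
set m := lead_monomial _ _ in lm_p lm_max *.
have [/existsP[i /existsP[j /and3P[eij wij ijm]]]|m_std] :=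
  boolP [exists i, exists j, [&& e i j, (w i < w j)%N & (xymon i j <= m)%MM]].
  by exists i, j.
have m_irr c : ~~ swap e w m c.
  apply: contra m_std => /swapP[k [i [j [eij wij -> _]]]].
  by apply/existsP; exists i; apply/existsP; exists j; rewrite eij wij lem_addl.
pose d := msize p; pose bm : bmultinom (n + n) d := BMultinom (msize_mdeg_lt lm_p).
(* The class of [m]: a step preserves the degree, so the bound [d] loses only monomials of degree
   beyond the support of [p]. *)
pose s := [seq bmnm a | a <- enum {: bmultinom (n + n) d} & connect (@bswap n e w d) a bm].
have uniq_s : uniq s.
  by rewrite map_inj_uniq => [|a b /val_inj //]; exact/filter_uniq/enum_uniq.
have mem_s (c : bmultinom (n + n) d) : (bmnm c \in s) = connect (@bswap n e w d) c bm.
  by rewrite mem_map => [|x y /val_inj //]; rewrite mem_filter mem_enum andbT.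
have s_mdeg a : a \in s -> (mdeg a < d)%N by case/mapP=> c _ ->; exact: bmdeg.
have s_swap a b : swap e w a b -> (a \in s) = (b \in s).
  move=> ab; have [ad|da] := ltnP (mdeg a) d; last first.
    apply/idP/idP => /s_mdeg; first by rewrite ltnNge da.
    by rewrite -(swap_mdeg ab) ltnNge da.
  have bd : (mdeg b < d)%N by rewrite -(swap_mdeg ab).
  pose ca : bmultinom (n + n) d := BMultinom ad.
  pose cb : bmultinom (n + n) d := BMultinom bd.
  have ca_cb : swap e w ca cb := ab.
  have := connect_bswap (m := bm) e_sym w_bij e_closed m_irr ca_cb.
  by rewrite -!mem_s.
have sum0 : \sum_(a <- s) p@_a = 0.
  apply: sum_mcoeff_eq0 Jp => k i j eij; rewrite !count_uniq_mem //; congr nat_of_bool.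
  have [wij|wji|/val_inj/(bij_inj w_bij) -> //] := ltngtP (w i) (w j).
    by apply: s_swap; apply/swapP; exists k, i, j.
  by apply/esym/s_swap/swapP; exists k, j, i; rewrite e_sym.
have ms : m \in s by rewrite -[m]/(bmnm bm) mem_s connect0.
(* Every other member of [s] has larger weight than [m], hence lies outside the support of [p]; the
   vanishing sum reduces to the nonzero coefficient at [m]. *)
move: sum0 (lm_p); rewrite (bigD1_seq m) //= big1_seq.
  by rewrite addr0 mcoeff_msupp => ->; rewrite eqxx.
move=> a /andP[a_neq_m /mapP[c + aE]]; rewrite mem_filter => /andP[cm _].
apply/eqP; rewrite mcoeff_eq0; apply: contra a_neq_m => /lm_max.
have [c_bm|c_neq] := eqVneq c bm; first by rewrite aE c_bm eqxx.
have := connect_bswap_xweight cm c_neq.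
by rewrite -aE /xweight_le; case: ltngtP.
Qed.

Lemma closed_quadratic_groebner (n : nat) (K : fieldType) (e : rel 'I_n) :
  ssrbool.symmetric e -> irreflexive e -> closed_graph e ->
  exists (le : rel 'X_{1..n + n}) (B : seq {mpoly K[n + n]}),
    term_order le /\ quadratic_groebner_basis le (binomial_edge_ideal K e) B.
Proof.
move=> e_sym e_irr [w [w_bij e_closed]]; pose le := xweight_le w.
have le_to := xweight_term_order w.
(* Each edge is oriented by increasing label, so that the leading monomial of its binomial is
   [xymon i j]. *)
pose B := [seq edge_binomial K ij.1 ij.2 | ij <- enum {: 'I_n * 'I_n}
            & e ij.1 ij.2 && (w ij.1 < w ij.2)%N].
have BP g : reflect (exists i j, [/\ e i j, (w i < w j)%N & g = edge_binomial K i j])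
    (g \in B).
  apply: (iffP mapP) => [[[i j]]|[i [j [eij wij ->]]]].
    by rewrite mem_filter => /andP[/andP[eij wij] _] ->; exists i, j.
  by exists (i, j); rewrite // mem_filter eij wij mem_enum.
have B_neq0 i j : (w i < w j)%N -> edge_binomial K i j != 0 /\
    lead_monomial le (edge_binomial K i j) = xymon i j.
  move=> wij; have ij : xymon i j != xymon j i.
    by apply: contraTneq wij => /xymon_inj[-> _]; rewrite ltnn.
  have ij_supp : xymon i j \in msupp (edge_binomial K i j).
    rewrite mcoeff_msupp edge_binomialE mcoeffB !mcoeffX eqxx.
    by rewrite [_ == xymon i j]eq_sym (negPf ij) subr0 oner_eq0.
  have f_neq0 : edge_binomial K i j != 0.
    by rewrite -msupp_eq0; apply: contraTneq ij_supp => ->.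
  split=> //; have [lm_f lm_max] := lead_monomialP le_to f_neq0.
  apply: (term_order_anti le_to); rewrite lm_max // andbT.
  move: lm_f; rewrite [X in _ \in msupp X]edge_binomialE => /msuppB_le; rewrite !msuppX !inE.
  case/orP=> /eqP ->; first exact: term_order_refl le_to _.
  rewrite /xweight_le !xweight_xymon; have := ltn_ord (w j); case: ltngtP; lia.
exists le, B; split=> //; split; first split.
- move=> g /BP[i [j [eij wij ->]]]; split; last by have [] := B_neq0 i j wij.
  exact: edge_binomial_mem.
- move=> q; split; apply: ideal_gen_sub => {}q.
    case=> p [Jp p_neq0 ->].
    have [i [j [eij wij ij_lm]]] := closed_lead_dvd e_sym w_bij e_closed Jp p_neq0.
    rewrite -(submK ij_lm) mpolyXD; apply/ideal_genMl/ideal_gen_mem.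
    exists (edge_binomial K i j); first by apply/BP; exists i, j.
    by have [_ ->] := B_neq0 i j wij.
  case=> g /BP[i [j [eij wij ->]]] ->; apply: ideal_gen_mem.
  exists (edge_binomial K i j); split=> //; last by have [] := B_neq0 i j wij.
  exact: edge_binomial_mem.
- move=> g /BP[i [j [_ _ ->]]]; rewrite edge_binomialE.
  by apply: rpredB; rewrite dhomogX /= mdeg_xymon.
Qed.

Theorem theorem2p4 (n : nat) (K : fieldType) (e : rel 'I_n)
    (e_sym : ssrbool.symmetric e) (e_irr : irreflexive e)
    (e_iso : no_isolated_vertex e) :
  closed_graph e <->
  exists (le : rel 'X_{1..n + n}) (B : seq {mpoly K[n + n]}),
    term_order le /\ quadratic_groebner_basis le (binomial_edge_ideal K e) B.
Proof.
split; first exact: closed_quadratic_groebner.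
by move=> [le [B [le_to B_qgb]]]; exact: quadratic_groebner_closed le_to B_qgb.
Qed.
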